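(* Let $0<q<1$, $N\ge1$ an integer, $\mathcal X=\{0,1,\dots,N\}$, $0<a_1<1$, $0<b_1<1$, $0<a_2<1$, $b_2<1$, and let, for $x,y\in\mathcal X$, $$K(x,y)=\sum_{z_2=0}^{\min(x,y)}\pi(z_2,y,a_1,b_1)\sum_{z_1=\max(x,y)}^{N}\pi(x-z_2,z_1-z_2,b_1,a_2)\,\pi(z_1-y,N-y,a_2,b_2),$$ where $\pi$ is the $q$-Hahn measure. Then $K(x,y)\ge0$, $\sum_{x\in\mathcal X}K(x,y)=1$, and with $\lambda=(a_1b_1,a_2b_2)$ one has, for all $x,y,n\in\mathcal X$, $$K(x,y)\,\pi(y,N,\lambda)=K(y,x)\,\pi(x,N,\lambda),$$ $$\sum_{y\in\mathcal X}K(x,y)\,\pi(y,N,\lambda)\,\check P_n(y,\lambda)=\kappa(n)\,\pi(x,N,\lambda)\,\check P_n(x,\lambda),$$ with $$\kappa(n)=\sum_{k=0}^{n}\frac{(q^{-n};q)_k(a_1b_1a_2b_2q^{n-1};q)_k(b_1;q)_k(a_2;q)_k}{(a_1b_1;q)_k(b_1a_2;q)_k(a_2b_2;q)_k(q;q)_k}q^k.$$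
   Context: $(a;q)_n=\prod_{i=0}^{n-1}(1-aq^i)$. The $q$-Hahn measure with parameters $0<a<1$, $b<1$ is, for integers $0\le x\le M$, $\pi(x,M,a,b)=\frac{(q;q)_M}{(q;q)_x(q;q)_{M-x}}\frac{(a;q)_x(b;q)_{M-x}a^{M-x}}{(ab;q)_M}$. The $q$-Hahn polynomials on $\mathcal X$ are $\check P_n(x,a,b)=\sum_{k=0}^n\frac{(q^{-n};q)_k(abq^{n-1};q)_k(q^{-x};q)_k}{(a;q)_k(q^{-N};q)_k(q;q)_k}q^k$. *)

(* Defs.v *)
From mathcomp Require Import all_boot all_order all_algebra.

Set Implicit Arguments.
Unset Strict Implicit.
Unset Printing Implicit Defensive.

Import Order.TTheory GRing.Theory Num.Theory.
Local Open Scope ring_scope.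

(* (a; q)_n *)
Definition qpoch (R : realFieldType) (q a : R) (n : nat) : R :=
  \prod_(i < n) (1 - a * q ^+ i).

(* q-Hahn measure pi(x, M, a, b); only meaningful for x <= M, since M - x is
   truncated subtraction. *)
Definition qHahn_measure (R : realFieldType) (q : R) (x M : nat) (a b : R) : R :=
  qpoch q q M / (qpoch q q x * qpoch q q (M - x)) *
  (qpoch q a x * qpoch q b (M - x) * a ^+ (M - x) / qpoch q (a * b) M).

(* The exponent n - 1 is an integer: it is -1 when n = 0. *)
Definition qHahn_poly (R : realFieldType) (q : R) (N n x : nat) (a b : R) : R :=
  \sum_(0 <= k < n.+1)
    (qpoch q (q ^- n) k * qpoch q (a * b * q ^ (n%:Z - 1)) k * qpoch q (q ^- x) k) /
    (qpoch q a k * qpoch q (q ^- N) k * qpoch q q k) * q ^+ k.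

(* K(x, y); all truncated subtractions below have a nonnegative true value in
   the ranges of summation, for x, y <= N. *)
Definition qHahn_kernel (R : realFieldType) (q : R) (N : nat)
    (a1 b1 a2 b2 : R) (x y : nat) : R :=
  \sum_(0 <= z2 < (minn x y).+1)
    qHahn_measure q z2 y a1 b1 *
    \sum_(maxn x y <= z1 < N.+1)
      qHahn_measure q (x - z2) (z1 - z2) b1 a2 *
      qHahn_measure q (z1 - y) (N - y) a2 b2.

Definition qHahn_kappa (R : realFieldType) (q a1 b1 a2 b2 : R) (n : nat) : R :=
  \sum_(0 <= k < n.+1)
    (qpoch q (q ^- n) k * qpoch q (a1 * b1 * a2 * b2 * q ^ (n%:Z - 1)) k *
     qpoch q b1 k * qpoch q a2 k) /
    (qpoch q (a1 * b1) k * qpoch q (b1 * a2) k * qpoch q (a2 * b2) k *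
     qpoch q q k) * q ^+ k.

(* Main.v *)
Require Import Defs.
From mathcomp Require Import all_boot all_order all_algebra.
From mathcomp Require Import ring zify.

Set Implicit Arguments.
Unset Strict Implicit.
Unset Printing Implicit Defensive.

Import Order.TTheory GRing.Theory Num.Theory.
Local Open Scope ring_scope.

(* Given [y], the kernel draws [z2 <= y] and [z1 >= y] independently, then [x]
   between [z2] and [z1].  Detailed balance holds for each fixed [(z1, z2)], so
   [T f x = \sum_y K y x * f y] is self-adjoint for the weight [w].  The factorial
   moments [E[(q^-x; q)_k] = (a; q)_k (q^-M; q)_k / (ab; q)_k] of the q-Hahn
   measure show that [T] preserves the degree of polynomials in [q^-x].  As P_n
   has degree n and is orthogonal to lower degrees, [T P_n - c P_n] is, for a
   suitable [c], of degree < n and orthogonal to itself, hence zero.  Evaluation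
   at [x = 0], where [P_n = 1], gives [c = kappa n]. *)

(** * q-shifted factorials, Gaussian binomials and their summation formulas *)

Section QPochhammer.
Variables (R : realFieldType) (q : R).
Hypothesis hq : 0 < q < 1.
Implicit Types (a b z : R) (n k m : nat).

Lemma q_neq0 : q != 0.
Proof. by case/andP: hq => q0 _; rewrite gt_eqF. Qed.

Lemma qX_neq0 n : q ^+ n != 0.
Proof. by rewrite expf_neq0 // q_neq0. Qed.

Lemma qV_lt1S n : 1 < q ^- n.+1.
Proof.
case/andP: hq => q0 q1; rewrite invf_gt1 ?exprn_gt0 //.
by rewrite exprn_ilt1 // ltW.
Qed.

Lemma mulqX_lt1 a n : a < 1 -> a * q ^+ n < 1.
Proof.
case/andP: hq => q0 q1 a1; have [a0|a0] := lerP a 0.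
  by apply: le_lt_trans ltr01; rewrite mulr_le0_ge0 // exprn_ge0 // ltW.
apply: le_lt_trans a1; rewrite ler_piMr ?(ltW a0) //.
by rewrite exprn_ile1 // ltW.
Qed.

Lemma qpoch0 a : qpoch q a 0 = 1.
Proof. by rewrite /qpoch big_ord0. Qed.

Lemma qpochSr a n : qpoch q a n.+1 = qpoch q a n * (1 - a * q ^+ n).
Proof. by rewrite /qpoch big_ord_recr. Qed.

Lemma qpochD a m n : qpoch q a (m + n) = qpoch q a m * qpoch q (a * q ^+ m) n.
Proof.
elim: n => [|n IH]; first by rewrite addn0 qpoch0 mulr1.
by rewrite addnS !qpochSr IH exprD !mulrA.
Qed.

Lemma qpochSl a n : qpoch q a n.+1 = (1 - a) * qpoch q (a * q) n.
Proof. by rewrite -add1n qpochD qpochSr qpoch0 expr0 expr1 mulr1 mul1r. Qed.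

Lemma qpoch_gt0 a n : a < 1 -> 0 < qpoch q a n.
Proof. by move=> a1; apply: prodr_gt0 => i _; rewrite subr_gt0 mulqX_lt1. Qed.

Lemma qpoch_neq0 a n : a < 1 -> qpoch q a n != 0.
Proof. by move=> a1; rewrite gt_eqF // qpoch_gt0. Qed.

Lemma qfact_neq0 n : qpoch q q n != 0.
Proof. by rewrite qpoch_neq0; case/andP: hq. Qed.

Lemma qfactS n : qpoch q q n.+1 = qpoch q q n * (1 - q ^+ n.+1).
Proof. by rewrite qpochSr exprS. Qed.

Lemma one_sub_qXS_neq0 n : 1 - q ^+ n.+1 != 0.
Proof. by have := qfact_neq0 n.+1; rewrite qfactS mulf_eq0; case/norP. Qed.

Lemma qpochVS n k :
  qpoch q (q ^- n.+1) k.+1 = (1 - q ^- n.+1) * qpoch q (q ^- n) k.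
Proof.
rewrite qpochSl; congr (_ * qpoch q _ k).
by rewrite exprS; field; rewrite q_neq0 qX_neq0.
Qed.

Lemma qpochV_eq0 n k : (n < k)%N -> qpoch q (q ^- n) k = 0.
Proof.
move=> nk; rewrite /qpoch (bigD1 (Ordinal nk)) //=.
by rewrite mulVf ?qX_neq0 // subrr mul0r.
Qed.

Lemma qpochV_neq0 n k : (k <= n)%N -> qpoch q (q ^- n) k != 0.
Proof.
elim: k n => [|k IH] [|n] // kn; rewrite ?qpoch0 ?oner_eq0 //.
rewrite qpochVS mulf_neq0 ?IH //.
by rewrite subr_eq0 eq_sym gt_eqF // qV_lt1S.
Qed.

(** The Gaussian binomial coefficient, defined by the q-Pascal rule so that sums over a row can be
    treated by induction; it vanishes for [k > n]. *)
Fixpoint qbinom n k : R :=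
  match n, k with
  | _, 0 => 1
  | 0, _.+1 => 0
  | n'.+1, k'.+1 => qbinom n' k' + q ^+ k'.+1 * qbinom n' k'.+1
  end.

Lemma qbinom0 n : qbinom n 0 = 1.
Proof. by case: n. Qed.

Lemma qbinom_small n k : (n < k)%N -> qbinom n k = 0.
Proof.
elim: n k => [|n IH] [|k] //= nk.
by rewrite !IH ?mulr0 ?addr0 // ltnW.
Qed.

(** Double induction along the q-Pascal rule. Writing the row as [n + k] avoids truncated
    subtraction. *)
Lemma qbinom_fact n k : qpoch q q (n + k) =
  qbinom (n + k) k * (qpoch q q k * qpoch q q n).
Proof.
elim: n k => [|n IHn] k.
  rewrite add0n qpoch0 mulr1; elim: k => [|k IHk] /=; first by rewrite mul1r.
  rewrite (qbinom_small (ltnSn k)) mulr0 addr0.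
  by rewrite !qfactS {1}IHk mulrA.
elim: k => [|k IHk]; first by rewrite addn0 /= mul1r qpoch0 mul1r.
have pascal : qbinom (n.+1 + k.+1) k.+1 =
    qbinom (n.+1 + k) k + q ^+ k.+1 * qbinom (n + k.+1) k.+1.
  by rewrite -(addSnnS n) addnS.
have e1 : qbinom (n.+1 + k) k * (qpoch q q k.+1 * qpoch q q n.+1) =
  qpoch q q (n.+1 + k) * (1 - q ^+ k.+1).
  by rewrite IHk (qfactS k); ring.
have e2 : qbinom (n + k.+1) k.+1 * (qpoch q q k.+1 * qpoch q q n.+1) =
  qpoch q q (n + k.+1) * (1 - q ^+ n.+1).
  by rewrite IHn (qfactS n); ring.
(* The two contributions add up by $(1-q^{k+1}) + q^{k+1}(1-q^{n+1}) = 1-q^{n+k+2}$. *)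
rewrite pascal mulrDl -mulrA e1 e2 !addSnnS (addnS n k.+1) qfactS.
have -> : q ^+ (n + k.+1).+1 = q ^+ n.+1 * q ^+ k.+1 by rewrite -exprD addSn.
ring.
Qed.

Lemma qbinomE n k : (k <= n)%N ->
  qpoch q q n / (qpoch q q k * qpoch q q (n - k)) = qbinom n k.
Proof.
move=> kn; have := qbinom_fact (n - k) k; rewrite subnK // => ->.
by rewrite mulfK // mulf_neq0 // qfact_neq0.
Qed.

(** The q-Pascal rule at the level of sums: it reduces the induction steps of the next two
    identities to a check term by term. *)
Lemma sum_qbinomS (f : nat -> R) n :
  \sum_(k < n.+2) qbinom n.+1 k * f k =
  \sum_(k < n.+1) qbinom n k * (q ^+ k * f k + f k.+1).
Proof.
rewrite big_ord_recl /= mul1r.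
under eq_bigr => i _ do rewrite /= /bump /= add0n add1n mulrDl.
rewrite big_split /=.
under [RHS]eq_bigr => i _ do rewrite mulrDr.
rewrite big_split /= addrCA [RHS]addrC; congr (_ + _).
rewrite big_ord_recr /= qbinom_small // mulr0 mul0r addr0.
rewrite [RHS]big_ord_recl /= qbinom0 expr0 !mul1r; congr (_ + _).
by apply: eq_bigr => i _; rewrite /= /bump /= add1n mulrA [_ * q ^+ _]mulrC.
Qed.

(** Normalisation of the q-Hahn measure. In the induction step each term is multiplied by
    $aq^k(1-bq^{n-k}) + (1-aq^k) = 1-abq^n$, which does not depend on [k]. *)
Lemma qVandermonde a b n :
  \sum_(k < n.+1) qbinom n k *
    (qpoch q a k * qpoch q b (n - k) * a ^+ (n - k)) = qpoch q (a * b) n.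
Proof.
elim: n => [|n IH]; first by rewrite big_ord1 /= !qpoch0 expr0 !mulr1.
rewrite (sum_qbinomS (fun k =>
  qpoch q a k * qpoch q b (n.+1 - k) * a ^+ (n.+1 - k))).
rewrite qpochSr -IH mulr_suml; apply: eq_bigr => -[k /= kn] _.
rewrite subSS subSn // !qpochSr exprS.
have -> : q ^+ n = q ^+ k * q ^+ (n - k) by rewrite -exprD subnKC.
ring.
Qed.

(** The product over [i < k] is $(-z)^k q^{k(k-1)/2}$. Going from [n] to [n.+1], each term $f_k$
    becomes $q^kf_k + f_{k+1} = (1-z)q^kf_k$, and $q^kf_k$ is the term for $zq$. *)
Lemma qbinomial_theorem z n :
  \sum_(k < n.+1) qbinom n k * \prod_(i < k) (- z * q ^+ i) = qpoch q z n.
Proof.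
elim: n z => [|n IH] z; first by rewrite big_ord1 /= big_ord0 qpoch0 mulr1.
rewrite (sum_qbinomS (fun k => \prod_(i < k) (- z * q ^+ i))).
rewrite qpochSl -IH mulr_sumr; apply: eq_bigr => k _.
have -> : \prod_(i < k) (- (z * q) * q ^+ i) =
          q ^+ k * \prod_(i < k) (- z * q ^+ i) :> R.
  rewrite -[in q ^+ k](card_ord k) -prodr_const -big_split /=.
  by apply: eq_bigr => i _; ring.
by rewrite big_ord_recr /=; ring.
Qed.

(** Turns terminating hypergeometric sums into sums covered by the q-binomial theorem at $z =
    q^{-n}$ times a power of $q$. Both sides vanish for [k > n]. *)
Lemma qpochV_qfact n k : qpoch q (q ^- n) k / qpoch q q k =
  qbinom n k * \prod_(i < k) (- q ^- n * q ^+ i).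
Proof.
have [nk|kn] := ltnP n k; first by rewrite qpochV_eq0 // qbinom_small // !mul0r.
rewrite -qbinomE //.
suff -> : qpoch q q n = qpoch q (q ^- n) k * qpoch q q (n - k) /
                        \prod_(i < k) (- q ^- n * q ^+ i).
  field; rewrite !qfact_neq0 /= ?andbT.
  by apply/prodf_neq0 => i _; rewrite mulf_neq0 ?oppr_eq0 ?invr_eq0 ?qX_neq0.
elim: k kn => [|k IH] kn.
  by rewrite qpoch0 big_ord0 subn0 mul1r divr1.
rewrite IH 1?ltnW // big_ord_recr /= invfM qpochSr.
rewrite -(subnSK kn) qfactS subnSK //.
have -> : q ^+ n = q ^+ (n - k) * q ^+ k by rewrite -exprD subnK // ltnW.
field; rewrite !qX_neq0 /=; apply/prodf_neq0 => i _.
by rewrite mulf_neq0 ?oppr_eq0 ?invr_eq0 ?mulf_neq0 ?qX_neq0.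
Qed.

End QPochhammer.

(** * Polynomials and graded bases *)

(** A linear property of polynomials of degree below [n] need only be checked on one polynomial of
    each degree: subtracting the multiple of [B n] with the same coefficient of ['X^n] lowers the
    size. Each use picks the basis that makes its sum explicit. *)
Lemma poly_span_ind (R : fieldType) (P : {poly R} -> Prop) (B : nat -> {poly R}) n :
  P 0 -> (forall c p r, P p -> P r -> P (c *: p + r)) ->
  (forall k, size (B k) = k.+1) -> (forall k, (k < n)%N -> P (B k)) ->
  forall p : {poly R}, (size p <= n)%N -> P p.
Proof.
move=> P0 PZD sB; elim: n => [|n IH] PB p sp.
  by move: sp; rewrite leqn0 size_poly_eq0 => /eqP ->.
have lB : (B n)`_n != 0.
  by have := lead_coef_eq0 (B n); rewrite lead_coefE sB -size_poly_eq0 sB => ->.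
rewrite -[p](subrKC ((p`_n / (B n)`_n) *: B n)); apply: PZD; first exact: PB.
apply: IH => [k kn|]; first exact: PB (ltnW kn).
apply/leq_sizeP => j; rewrite leq_eqVlt => /orP[/eqP <-|nj].
  by rewrite coefB coefZ divfK // subrr.
rewrite coefB coefZ [p`_j]nth_default ?(leq_trans sp) //.
by rewrite [(B n)`_j]nth_default ?sB // mulr0 subrr.
Qed.

(** The polynomial $(cX;q)_k$; it is evaluated at $X = q^{-x}$, or at $X = q^k$ in hypergeometric
    sums. *)
Definition qpoch_poly (R : realFieldType) (q c : R) (k : nat) : {poly R} :=
  \prod_(i < k) (1 - (c * q ^+ i) *: 'X).

Lemma horner_qpoch_poly (R : realFieldType) (q c t : R) k :
  (qpoch_poly q c k).[t] = qpoch q (c * t) k.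
Proof.
rewrite /qpoch_poly horner_prod; apply: eq_bigr => i _.
by rewrite !hornerE mulrAC.
Qed.

Lemma size_qpoch_poly_leq (R : realFieldType) (q c : R) k :
  (size (qpoch_poly q c k) <= k.+1)%N.
Proof.
elim: k => [|k IH]; first by rewrite /qpoch_poly big_ord0 size_poly1.
rewrite /qpoch_poly big_ord_recr /= mulrBr mulr1 -scalerAr.
rewrite (leq_trans (size_polyD _ _)) // geq_max (leqW IH) size_polyN.
rewrite (leq_trans (size_scale_leq _ _)) // (leq_trans (size_polyMleq _ _)) //.
by rewrite size_polyX addn2.
Qed.

Lemma size_qpoch_poly (R : realFieldType) (q c : R) k :
  0 < q < 1 -> c != 0 -> size (qpoch_poly q c k) = k.+1.
Proof.
move=> hq c0; elim: k => [|k IH]; first by rewrite /qpoch_poly big_ord0 size_poly1.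
have d0 : - (c * q ^+ k) != 0 by rewrite oppr_eq0 mulf_neq0 // qX_neq0.
have s2 : size (1 - (c * q ^+ k) *: 'X : {poly R}) = 2%N.
  by rewrite addrC -scaleNr size_polyDl size_scale // size_polyX // size_poly1.
rewrite /qpoch_poly big_ord_recr /= -/(qpoch_poly q c k).
by rewrite size_mul -?size_poly_eq0 ?s2 ?IH // addn2.
Qed.

(** * The q-Hahn measure: total mass, parameter shifts and moments *)

Section QHahnMeasure.
Variables (R : realFieldType) (q : R).
Hypothesis hq : 0 < q < 1.
Implicit Types (a b : R) (x M k : nat).

Lemma qHahn_measureE x M a b : (x <= M)%N -> qHahn_measure q x M a b =
  qbinom q M x * (qpoch q a x * qpoch q b (M - x) * a ^+ (M - x)) /
  qpoch q (a * b) M.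
Proof. by move=> xM; rewrite /qHahn_measure qbinomE // mulrA. Qed.

Lemma sum_qHahn_measure M a b : a * b < 1 ->
  \sum_(x < M.+1) qHahn_measure q x M a b = 1.
Proof.
move=> ab1; under eq_bigr => x _ do rewrite qHahn_measureE ?leq_ord //.
by rewrite -mulr_suml qVandermonde // divff // qpoch_neq0.
Qed.

Lemma one_sub_neq0 a : a < 1 -> 1 - a != 0.
Proof. by move=> a1; rewrite gt_eqF // subr_gt0. Qed.

Lemma ltr1_mul a b : 0 <= a -> a < 1 -> b < 1 -> a * b < 1.
Proof.
move=> a0 a1 b1; have [b0|b0] := lerP b 0.
  by apply: le_lt_trans ltr01; rewrite mulr_ge0_le0.
by apply: le_lt_trans b1; rewrite ler_piMl // ltW.
Qed.

Lemma qHahn_measure_gt0 x M a b : 0 < a -> a < 1 -> b < 1 ->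
  0 < qHahn_measure q x M a b.
Proof.
move=> a0 a1 b1; have q1 : q < 1 by case/andP: hq.
have ab1 : a * b < 1 by rewrite ltr1_mul // ltW.
by rewrite /qHahn_measure !(mulr_gt0, invr_gt0, exprn_gt0, qpoch_gt0).
Qed.

(** The first factor of $(q^{-x};q)_{k+1}$ is absorbed into the measure by lowering [x] and [M] and
    replacing [a] by [a * q]. This drives the induction for the factorial moments. *)
Lemma qHahn_measure_shift_first x M a b : (x <= M)%N -> a * b < 1 ->
  qHahn_measure q x.+1 M.+1 a b * (1 - q ^- x.+1) =
  (1 - a) * (1 - q ^- M.+1) / (1 - a * b) * qHahn_measure q x M (a * q) b.
Proof.
move=> xM ab1; rewrite /qHahn_measure subSS.
have -> : qpoch q a x.+1 = (1 - a) * qpoch q (a * q) x by rewrite qpochSl.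
have -> : qpoch q (a * b) M.+1 = (1 - a * b) * qpoch q (a * q * b) M.
  by rewrite qpochSl mulrAC.
rewrite !qfactS exprMn.
have -> : q ^+ M.+1 = q ^+ x.+1 * q ^+ (M - x) by rewrite -exprD addSn subnKC.
field; rewrite !qX_neq0 // !qfact_neq0 // one_sub_qXS_neq0 //=.
rewrite one_sub_neq0 // qpoch_neq0 //.
by rewrite mulrAC -[q]expr1 mulqX_lt1.
Qed.

(** Counterpart for [b]: the factor $1-q^{M+1-x}$ cancels the last factor of $(q;q)_{M+1-x}$. *)
Lemma qHahn_measure_shift_second x M a b : (x <= M)%N -> a * b < 1 ->
  qHahn_measure q x M.+1 a b * (1 - q ^+ M.+1 * q ^- x) =
  a * (1 - b) * (1 - q ^+ M.+1) / (1 - a * b) * qHahn_measure q x M a (b * q).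
Proof.
move=> xM ab1; rewrite /qHahn_measure subSn //.
have -> : qpoch q (a * b) M.+1 = (1 - a * b) * qpoch q (a * (b * q)) M.
  by rewrite qpochSl mulrA.
have -> : q ^+ M.+1 * q ^- x = q ^+ (M - x).+1.
  by rewrite -subSn // expfB_cond // (negPf (q_neq0 hq)) leqW.
rewrite !qfactS [qpoch q b _]qpochSl [a ^+ _.+1]exprS.
field; rewrite !qfact_neq0 // one_sub_qXS_neq0 //=.
rewrite one_sub_neq0 // qpoch_neq0 //.
by rewrite mulrA -[q]expr1 mulqX_lt1.
Qed.

Lemma qHahn_factorial_moment M a b k : a * b < 1 ->
  \sum_(x < M.+1) qHahn_measure q x M a b * qpoch q (q ^- x) k =
  qpoch q a k * qpoch q (q ^- M) k / qpoch q (a * b) k.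
Proof.
elim: k M a => [|k IH] M a ab1.
  under eq_bigr => x _ do rewrite qpoch0 mulr1.
  by rewrite sum_qHahn_measure // !qpoch0 mulr1 divr1.
(* The term [x = 0] vanishes because $(1;q)_{k+1} = 0$; the others are shifted down. *)
rewrite big_ord_recl /= [qpoch q (q ^- 0) _]qpochV_eq0 // mulr0 add0r.
case: M => [|M]; first by rewrite big_ord0 qpochV_eq0 // mulr0 mul0r.
set C := (1 - a) * (1 - q ^- M.+1) / (1 - a * b).
under eq_bigr => x _ do rewrite /bump add1n qpochVS // mulrA
  qHahn_measure_shift_first ?leq_ord // -/C -mulrA.
have abq : a * q * b < 1 by rewrite mulrAC -[q]expr1 mulqX_lt1.
rewrite -mulr_sumr IH // qpochVS // /C [qpoch q a _]qpochSl [qpoch q (a * b) _]qpochSl.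
have -> : a * b * q = a * q * b by rewrite mulrAC.
by field; rewrite qpoch_neq0 // one_sub_neq0 // qX_neq0.
Qed.

(** As a function of [x], $(q^{M+1-x};q)_j$ vanishes exactly at $x = M+1,\dots,M+j$ within the
    range, so it cuts the sum at [M] while shifting [b] by $q^j$. The constant stays implicit:
    orthogonality only asks whether the right side is zero. *)
Lemma qHahn_measure_shift_sum M a b j : a * b < 1 -> exists C, forall f : nat -> R,
  \sum_(x < (M + j).+1)
    qHahn_measure q x (M + j) a b * (qpoch q (q ^+ M.+1 * q ^- x) j * f x) =
  C * \sum_(x < M.+1) qHahn_measure q x M a (b * q ^+ j) * f x.
Proof.
elim: j b => [|j IH] b ab1.
  exists 1 => f; rewrite addn0 mul1r expr0 mulr1.
  by apply: eq_bigr => x _; rewrite qpoch0 mul1r.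
have abq : a * (b * q) < 1 by rewrite mulrA -[q]expr1 mulqX_lt1.
have [C HC] := IH _ abq.
pose D := a * (1 - b) * (1 - q ^+ (M + j).+1) / (1 - a * b).
exists (D * C) => f; rewrite addnS big_ord_recr /= qpochSr.
have -> : q ^+ M.+1 * q ^- (M + j).+1 * q ^+ j = 1.
  by rewrite mulrAC -exprD addSn divff // qX_neq0.
rewrite subrr mulr0 mul0r mulr0 addr0 -[D * C * _]mulrA.
have -> : b * q ^+ j.+1 = b * q * q ^+ j by rewrite exprS mulrA.
rewrite -HC mulr_sumr; apply: eq_bigr => x _.
rewrite [RHS]mulrA -qHahn_measure_shift_second ?leq_ord //.
have -> : q ^+ (M + j).+1 = q ^+ M.+1 * q ^+ j by rewrite -exprD addSn.
by rewrite qpochSr; ring.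
Qed.

(** By the factorial moments, expectation is diagonal in the basis $(q^{-x};q)_k$: it yields a
    scalar times $(q^{-M};q)_k$. One [p'] serves all [M]. *)
Lemma qHahn_degree_preserving a b m (p : {poly R}) : a * b < 1 ->
  (size p <= m)%N -> exists2 p' : {poly R}, (size p' <= m)%N &
  forall M, \sum_(x < M.+1) qHahn_measure q x M a b * p.[q ^- x] = p'.[q ^- M].
Proof.
move=> ab1; move: p; apply: (@poly_span_ind _ _ (qpoch_poly q 1)).
- exists 0 => [|M]; rewrite ?size_poly0 // horner0 big1 // => x _.
  by rewrite horner0 mulr0.
- move=> c p r [p' sp Hp] [r' sr Hr]; exists (c *: p' + r') => [|M].
    rewrite (leq_trans (size_polyD _ _)) // geq_max sr andbT.
    exact: leq_trans (size_scale_leq _ _) sp.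
  rewrite hornerD hornerZ -Hp -Hr mulr_sumr -big_split /=.
  by apply: eq_bigr => x _; rewrite hornerD hornerZ; ring.
- by move=> k; rewrite size_qpoch_poly // oner_eq0.
move=> k km; exists ((qpoch q a k / qpoch q (a * b) k) *: qpoch_poly q 1 k).
  by rewrite (leq_trans (size_scale_leq _ _)) // size_qpoch_poly // oner_eq0.
move=> M; rewrite hornerZ horner_qpoch_poly mul1r mulrAC.
rewrite -qHahn_factorial_moment //.
by apply: eq_bigr => x _; rewrite horner_qpoch_poly mul1r.
Qed.

(** A q-analogue of the fact that an [n]-th difference kills degree below [n]. On ['X^m] the
    q-binomial theorem evaluates the sum to $(q^{m+1-n};q)_n$. *)
Lemma sum_qpochV_poly_eq0 n (p : {poly R}) : (size p <= n)%N ->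
  \sum_(k < n.+1) qpoch q (q ^- n) k / qpoch q q k * q ^+ k * p.[q ^+ k] = 0.
Proof.
move: p; apply: (@poly_span_ind _ _ (fun k => 'X^k)).
- by rewrite big1 // => k _; rewrite horner0 mulr0.
- move=> c p r Hp Hr; under eq_bigr do rewrite hornerD hornerZ mulrDr mulrCA.
  by rewrite big_split -mulr_sumr /= Hp Hr mulr0 addr0.
- by move=> k; rewrite size_polyXn.
move=> m mn; transitivity (qpoch q (q ^- n * q ^+ m.+1) n); last first.
  (* The factor of index $n-m-1$ is $1-q^0 = 0$. *)
  have imn : (n - m.+1 < n)%N by rewrite ltn_subrL; case: n mn.
  rewrite /qpoch (bigD1 (Ordinal imn)) //= -mulrA -exprD subnKC //.
  by rewrite mulVf ?qX_neq0 // subrr mul0r.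
rewrite -qbinomial_theorem; apply: eq_bigr => k _.
rewrite qpochV_qfact // hornerXn -!mulrA; congr (_ * _).
have -> : q ^+ k * q ^+ k ^+ m = \prod_(i < k) q ^+ m.+1.
  by rewrite prodr_const card_ord -!exprM -exprD mulnC mulSn.
by rewrite -big_split; apply: eq_bigr => i _ /=; ring.
Qed.

End QHahnMeasure.

(** * Reindexing of sums and reversal of polynomials *)

(** Moves variable bounds into 0/1 factors over a fixed range, so that nested sums can be
    exchanged. *)
Lemma big_nat_indicator (R : pzSemiRingType) (F : nat -> R) m n L : (n <= L)%N ->
  \sum_(m <= i < n) F i = \sum_(i < L) (m <= i < n)%:R * F i.
Proof.
move=> nL; rewrite (big_nat_widen _ _ _ _ _ nL) (big_nat_widenl _ 0) //.
rewrite big_mkord big_mkcond; apply: eq_bigr => i _ /=.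
by rewrite andbC; case: ifP; rewrite ?mul1r ?mul0r.
Qed.

Lemma expr_subn_chain (R : pzSemiRingType) (t : R) k m n :
  (k <= m)%N -> (m <= n)%N -> t ^+ (n - k) = t ^+ (n - m) * t ^+ (m - k).
Proof. by move=> km mn; rewrite -exprD addnBA // subnK. Qed.

Lemma big_ord_subn (R : nmodType) (F : nat -> R) m n : (m <= n)%N ->
  \sum_(i < (n - m).+1) F i = \sum_(m <= i < n.+1) F (i - m)%N.
Proof.
move=> mn; rewrite -[X in \sum_(X <= _ < _) _]add0n big_addn subSn // big_mkord.
by apply: eq_bigr => i _; rewrite addnK.
Qed.

(** Meant for $t = q^{-x}$ and $c = q^{-N}$: a polynomial in $q^{-(N-x)} = c/t$ becomes one in
    $q^{-x}$ after multiplication by $t^l$. *)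
Lemma horner_reverse (R : fieldType) (p : {poly R}) (c : R) l :
  (size p <= l.+1)%N -> exists2 p' : {poly R}, (size p' <= l.+1)%N &
  forall t, t != 0 -> t ^+ l * p.[c / t] = p'.[t].
Proof.
move=> sp; exists (\poly_(s < l.+1) (p`_(l - s) * c ^+ (l - s))).
  exact: size_poly.
move=> t t0; rewrite horner_poly (horner_coef_wide _ sp) mulr_sumr.
rewrite (reindex_inj rev_ord_inj) /=; apply: eq_bigr => -[s /= sl] _.
rewrite subSS expr_div_n.
have -> : t ^+ l = t ^+ s * t ^+ (l - s) by rewrite -exprD subnKC.
by field; rewrite expf_neq0.
Qed.

(** * q-Hahn polynomials: degree and orthogonality *)

Section QHahnPolynomials.
Variables (R : realFieldType) (q : R).
Hypothesis hq : 0 < q < 1.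
Implicit Types (a b : R) (N n x : nat).

Definition qHahn_coef N n a b k : R :=
  (qpoch q (q ^- n) k * qpoch q (a * b * q ^ (n%:Z - 1)) k) /
  (qpoch q a k * qpoch q (q ^- N) k * qpoch q q k) * q ^+ k.

Lemma qHahn_polyE N n x a b : qHahn_poly q N n x a b =
  \sum_(k < n.+1) qHahn_coef N n a b k * qpoch q (q ^- x) k.
Proof.
rewrite /qHahn_poly big_mkord; apply: eq_bigr => k _.
by rewrite /qHahn_coef; ring.
Qed.

Lemma qHahn_poly0 N n a b : qHahn_poly q N n 0 a b = 1.
Proof.
rewrite qHahn_polyE big_ord_recl /= big1 => [|k _].
  by rewrite /qHahn_coef !qpoch0 expr0 !mulr1 divr1 addr0.
by rewrite [qpoch q (q ^- 0) _]qpochV_eq0 // mulr0.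
Qed.

Lemma qHahn_coef_neq0 N n a b : (n <= N)%N -> a < 1 -> a * b < 1 ->
  qHahn_coef N n a b n != 0.
Proof.
move=> nN a1 ab1; rewrite /qHahn_coef mulf_neq0 ?qX_neq0 //.
have nz : qpoch q (a * b * q ^ (n%:Z - 1)) n != 0.
  (* For [n = 0] the exponent is -1 and the bound on [a * b] says nothing about $abq^{-1}$, but the
     product is empty. *)
  case: n {nN} => [|n]; first by rewrite qpoch0 oner_eq0.
  have -> : n.+1%:Z - 1 = n%:Z by rewrite intS addrAC subrr add0r.
  by rewrite qpoch_neq0 // mulqX_lt1.
by rewrite !mulf_neq0 ?invr_eq0 ?mulf_neq0 ?qpochV_neq0 ?qfact_neq0 ?(qpoch_neq0 hq n a1).
Qed.

Lemma qHahn_poly_horner N n a b : (n <= N)%N -> a < 1 -> a * b < 1 ->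
  exists2 P : {poly R}, size P = n.+1 &
  forall x, qHahn_poly q N n x a b = P.[q ^- x].
Proof.
move=> nN a1 ab1.
exists (\sum_(k < n.+1) qHahn_coef N n a b k *: qpoch_poly q 1 k) => [|x].
  rewrite big_ord_recr /= addrC.
  have s1 : size (qHahn_coef N n a b n *: qpoch_poly q 1 n) = n.+1.
    by rewrite size_scale ?qHahn_coef_neq0 // size_qpoch_poly // oner_eq0.
  rewrite size_polyDl s1 // ltnS (leq_trans (size_sum _ _ _)) //.
  apply/bigmax_leqP => k _; rewrite (leq_trans (size_scale_leq _ _)) //.
  by rewrite size_qpoch_poly // oner_eq0.
rewrite qHahn_polyE horner_sum; apply: eq_bigr => k _.
by rewrite hornerZ horner_qpoch_poly mul1r.
Qed.

(** Up to a constant, this is the pairing of P_n with $(q^{M+1-x};q)_j$. The ratio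
    $(q^{-M};q)_k/(q^{-N};q)_k$ is a polynomial of degree [j] in $q^k$, and
    $(abq^{n-1};q)_k/(abq^j;q)_k$ one of degree at most [r]. Since [j + r < n],
    [sum_qpochV_poly_eq0] applies. *)
Lemma qHahn_coef_moment_sum_eq0 M j r a b :
  let n := (j + r).+1 in let N := (M + j)%N in
  (n <= N)%N -> a < 1 -> a * b < 1 ->
  \sum_(k < n.+1) qHahn_coef N n a b k *
    (qpoch q a k * qpoch q (q ^- M) k / qpoch q (a * (b * q ^+ j)) k) = 0.
Proof.
move=> n N nN a1 ab1.
have abj i : a * b * q ^+ i < 1 by rewrite mulqX_lt1.
pose p := qpoch_poly q (q ^- N) j * qpoch_poly q (a * b * q ^+ j) r.
have sp : (size p <= n)%N.
  rewrite (leq_trans (size_polyMleq _ _)) // -ltnS.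
  have := leq_add (size_qpoch_poly_leq q (q ^- N) j)
    (size_qpoch_poly_leq q (a * b * q ^+ j) r).
  rewrite /n; lia.
(* [c] is the inverse of [p.[1]], since the product of the two ratios equals 1 at [k = 0]. *)
pose c := (qpoch q (q ^- N) j * qpoch q (a * b * q ^+ j) r)^-1.
apply: etrans (mulr0 c).
rewrite -[X in c * X](sum_qpochV_poly_eq0 hq sp) mulr_sumr; apply: eq_bigr => -[k /= kn] _.
have nz i : (i <= N)%N -> qpoch q (q ^- N) i != 0 by apply: qpochV_neq0.
have nz1 := nz k (leq_trans (kn : k <= n)%N nN); have nz2 := nz j (leq_addl _ _).
have nz3 := qpoch_neq0 hq k (abj j); have nz4 := qpoch_neq0 hq r (abj j).
have nz5 := qpoch_neq0 hq k a1; have nz6 := qfact_neq0 hq k.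
rewrite /c /p hornerM !horner_qpoch_poly /qHahn_coef.
have -> : n%:Z - 1 = (j + r)%N by rewrite /n intS addrAC subrr add0r.
(* Two ways of splitting $(q^{-N};q)_{j+k}$; the same device is then used for $(abq^j;q)_{k+r}$. *)
have -> : qpoch q (q ^- M) k =
    qpoch q (q ^- N) k * qpoch q (q ^- N * q ^+ k) j / qpoch q (q ^- N) j.
  rewrite -qpochD addnC qpochD.
  have -> : q ^- N * q ^+ j = q ^- M.
    by rewrite exprD invfM divfK // qX_neq0.
  by rewrite mulrAC divff // mul1r.
have -> : qpoch q (a * b * q ^ (j + r)%N) k = qpoch q (a * b * q ^+ j) k *
    qpoch q (a * b * q ^+ j * q ^+ k) r / qpoch q (a * b * q ^+ j) r.
  rewrite -qpochD (addnC k) qpochD -exprnP exprD !mulrA.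
  by rewrite [qpoch q _ r * _]mulrC mulfK.
rewrite [a * (b * _)]mulrA; field.
by rewrite nz1 nz2 nz3 nz4 nz5 nz6.
Qed.

Lemma qHahn_poly_orthogonal N n a b (p : {poly R}) :
  (n <= N)%N -> a < 1 -> a * b < 1 -> (size p <= n)%N ->
  \sum_(x < N.+1) qHahn_measure q x N a b *
    (qHahn_poly q N n x a b * p.[q ^- x]) = 0.
Proof.
move=> nN a1 ab1; move: p.
(* The test polynomials $(q^{N-j+1-x};q)_j$ are absorbed by the weight, leaving factorial moments of
   a q-Hahn measure on [N - j] with [b] shifted. *)
apply: (@poly_span_ind _ _ (fun j => qpoch_poly q (q ^+ (N - j).+1) j)).
- by rewrite big1 // => x _; rewrite horner0 !mulr0.
- move=> c p r Hp Hr.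
  under eq_bigr do rewrite hornerD hornerZ !mulrDr ![_ * (c * _)]mulrCA.
  by rewrite big_split -mulr_sumr /= Hp Hr mulr0 addr0.
- by move=> k; rewrite size_qpoch_poly // qX_neq0.
move=> j jn; have jN : (j <= N)%N by rewrite (leq_trans (ltnW jn)).
have [M [r [eN en]]] : exists M r, N = (M + j)%N /\ n = (j + r).+1.
  by exists (N - j)%N, (n - j.+1)%N; lia.
subst N n; rewrite addnK.
under eq_bigr => x _ do rewrite horner_qpoch_poly [qHahn_poly _ _ _ _ _ _ * _]mulrC.
have [C HC] := qHahn_measure_shift_sum hq M j ab1.
rewrite (HC (fun x => qHahn_poly q (M + j) (j + r).+1 x a b)).
under eq_bigr => x _ do rewrite qHahn_polyE mulr_sumr.
rewrite exchange_big /=.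
have abj : a * (b * q ^+ j) < 1 by rewrite mulrA mulqX_lt1.
under eq_bigr => k _.
  under eq_bigr => x _ do rewrite mulrCA.
  rewrite -mulr_sumr qHahn_factorial_moment //; over.
by rewrite qHahn_coef_moment_sum_eq0 // mulr0.
Qed.

End QHahnPolynomials.

(** * The kernel: reversibility, action on polynomials, eigenvalues *)

Section QHahnKernel.
Variables (R : realFieldType) (q : R).
Hypothesis hq : 0 < q < 1.
Variables (N : nat) (a1 b1 a2 b2 : R).
Hypotheses (ha1 : 0 < a1 < 1) (hb1 : 0 < b1 < 1) (ha2 : 0 < a2 < 1) (hb2 : b2 < 1).

Notation K := (qHahn_kernel q N a1 b1 a2 b2).

(** Exhibits three successive draws: [z] for z2, then [u] with z1 = [x + u], then [v] with new state
    [z + v]. Expectations can then be taken one draw at a time. *)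
Lemma qHahn_kernel_sum (f : nat -> R) x : (x <= N)%N ->
  \sum_(y < N.+1) K y x * f y =
  \sum_(z < x.+1) qHahn_measure q z x a1 b1 *
  \sum_(u < (N - x).+1) qHahn_measure q u (N - x) a2 b2 *
  \sum_(v < (x + u - z).+1) qHahn_measure q v (x + u - z) b1 a2 * f (z + v)%N.
Proof.
move=> xN.
pose F z1 z2 y := qHahn_measure q z2 x a1 b1 *
  qHahn_measure q (z1 - x) (N - x) a2 b2 *
  qHahn_measure q (y - z2) (z1 - z2) b1 a2 * f y.
(* All sums are extended to [0..N]; the four inequalities together say $z_2\le\min(x,y)$ and
   $\max(x,y)\le z_1$. *)
transitivity (\sum_(z2 < N.+1) \sum_(z1 < N.+1) \sum_(y < N.+1)
  ([&& z2 <= x, x <= z1, z2 <= y & y <= z1]%N%:R * F z1 z2 y)).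
  rewrite [RHS](eq_bigr _ (fun z2 _ => exchange_big _ _ _ _ _ _)).
  rewrite exchange_big; apply: eq_bigr => y _ /=.
  have yN := leq_ord y.
  rewrite /qHahn_kernel (@big_nat_indicator _ _ _ _ N.+1); last first.
    by rewrite ltnS geq_min yN.
  rewrite mulr_suml; apply: eq_bigr => z2 _.
  rewrite (@big_nat_indicator _ _ _ _ N.+1) //.
  rewrite 2!mulr_sumr mulr_suml; apply: eq_bigr => z1 _ /=.
  rewrite !ltnS leq_min geq_max (leq_ord z1) andbT.
  by rewrite /F; do 4![case: leqP => _]; rewrite /=; ring.
rewrite -(big_mkord xpredT (fun z => qHahn_measure q z x a1 b1 *
  \sum_(u < (N - x).+1) qHahn_measure q u (N - x) a2 b2 *
  \sum_(v < (x + u - z).+1) qHahn_measure q v (x + u - z) b1 a2 * f (z + v)%N)).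
rewrite (@big_nat_indicator _ _ _ _ N.+1) //.
apply: eq_bigr => z2 _; rewrite /= ltnS.
have [z2x|] := leqP z2 x; last first.
  by rewrite mul0r => _; rewrite big1 // => z1 _; rewrite big1 // => y _; rewrite mul0r.
rewrite mul1r.
rewrite (big_ord_subn (fun u => qHahn_measure q u (N - x) a2 b2 *
  \sum_(v < (x + u - z2).+1) qHahn_measure q v (x + u - z2) b1 a2 * f (z2 + v)%N)) //.
rewrite (@big_nat_indicator _ _ _ _ N.+1) // mulr_sumr.
apply: eq_bigr => z1 _; rewrite (ltn_ord z1) andbT.
have [xz1|] := leqP x z1; last first.
  by rewrite mul0r mulr0 => _; rewrite big1 // => y _; rewrite mul0r.
rewrite mul1r subnKC //.
rewrite (big_ord_subn (fun v => qHahn_measure q v (z1 - z2) b1 a2 * f (z2 + v)%N));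
  last exact: leq_trans z2x xz1.
rewrite (@big_nat_indicator _ _ _ _ N.+1) // mulrA mulr_sumr.
apply: eq_bigr => y _; rewrite ltnS.
have [z2y|] := leqP z2 y; last by rewrite !mul0r mulr0.
by rewrite subnKC // /F /=; ring.
Qed.

Let a1b1 : a1 * b1 < 1.
Proof. by case/andP: ha1 hb1 => ? ? /andP[? ?]; rewrite ltr1_mul // ltW. Qed.
Let b1a2 : b1 * a2 < 1.
Proof. by case/andP: hb1 ha2 => ? ? /andP[? ?]; rewrite ltr1_mul // ltW. Qed.
Let a2b2 : a2 * b2 < 1.
Proof. by case/andP: ha2 => ? ?; rewrite ltr1_mul // ltW. Qed.
Let a1b1_gt0 : 0 < a1 * b1.
Proof. by case/andP: ha1 hb1 => ? ? /andP[? ?]; rewrite mulr_gt0. Qed.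
Let a1b1a2b2 : a1 * b1 * (a2 * b2) < 1.
Proof. by rewrite ltr1_mul // ltW. Qed.

Lemma qHahn_kernel_ge0 x y : 0 <= K x y.
Proof.
case/andP: ha1 hb1 ha2 => ? ? /andP[? ?] /andP[? ?].
rewrite /qHahn_kernel !big_mkord.
apply: sumr_ge0 => z2 _; rewrite mulr_ge0 ?(ltW (qHahn_measure_gt0 _ _ _ _ _ _)) //.
apply: sumr_ge0 => z1 _.
by rewrite mulr_ge0 ?(ltW (qHahn_measure_gt0 _ _ _ _ _ _)).
Qed.

Lemma qHahn_kernel_total x : (x <= N)%N -> \sum_(y < N.+1) K y x = 1.
Proof.
move=> xN; under eq_bigr => y _ do rewrite -[K y x]mulr1.
rewrite (qHahn_kernel_sum (fun=> 1)) //.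
under eq_bigr => z _.
  under eq_bigr => u _.
    under eq_bigr => v _ do rewrite mulr1.
    rewrite sum_qHahn_measure // mulr1; over.
  rewrite sum_qHahn_measure // mulr1; over.
by rewrite sum_qHahn_measure.
Qed.

(** Separates a factor depending only on [(z1, z2)] from one depending on [y]. Up to $b_1^{N-z_1}$,
    the latter has the same form as the [x] part of $\pi(x-z_2,z_1-z_2,b_1,a_2)$, hence the symmetry
    behind detailed balance. *)
Lemma qHahn_measure_chain y z1 z2 : (z2 <= y)%N -> (y <= z1)%N -> (z1 <= N)%N ->
  qHahn_measure q z2 y a1 b1 * qHahn_measure q (z1 - y) (N - y) a2 b2 *
    qHahn_measure q y N (a1 * b1) (a2 * b2) =
  qpoch q q N * qpoch q a1 z2 * qpoch q b2 (N - z1) *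
    a1 ^+ (N - z2) * a2 ^+ (N - z1) /
    (qpoch q q z2 * qpoch q q (N - z1) * qpoch q (a1 * b1 * (a2 * b2)) N) *
  (qpoch q b1 (y - z2) * qpoch q a2 (z1 - y) * b1 ^+ (N - y) /
    (qpoch q q (y - z2) * qpoch q q (z1 - y))).
Proof.
move=> z2y yz1 z1N; rewrite /qHahn_measure exprMn.
rewrite -subnDA subnKC // (expr_subn_chain a1 z2y (leq_trans yz1 z1N)).
field; rewrite !qfact_neq0 // !qpoch_neq0 //.
Qed.

Lemma qHahn_kernel_reversible x y : (x <= N)%N -> (y <= N)%N ->
  K x y * qHahn_measure q y N (a1 * b1) (a2 * b2) =
  K y x * qHahn_measure q x N (a1 * b1) (a2 * b2).
Proof.
move=> xN yN; rewrite /qHahn_kernel minnC maxnC !mulr_suml.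
apply: eq_big_nat => z2 /andP[_]; rewrite ltnS leq_min => /andP[z2y z2x].
rewrite -[LHS]mulrA -[RHS]mulrA !mulr_suml !mulr_sumr.
apply: eq_big_nat => z1 /andP[]; rewrite geq_max ltnS => /andP[yz1 xz1] z1N.
have E y' x' :
    qHahn_measure q z2 y' a1 b1 * (qHahn_measure q (x' - z2) (z1 - z2) b1 a2 *
      qHahn_measure q (z1 - y') (N - y') a2 b2 *
      qHahn_measure q y' N (a1 * b1) (a2 * b2)) =
    (qHahn_measure q z2 y' a1 b1 * qHahn_measure q (z1 - y') (N - y') a2 b2 *
      qHahn_measure q y' N (a1 * b1) (a2 * b2)) *
      qHahn_measure q (x' - z2) (z1 - z2) b1 a2 by ring.
rewrite !E // !qHahn_measure_chain // -[LHS]mulrA -[RHS]mulrA; congr (_ * _).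
rewrite /qHahn_measure.
rewrite -!subnDA !subnKC //.
rewrite (expr_subn_chain b1 yz1 z1N) (expr_subn_chain b1 xz1 z1N).
by field; rewrite !qfact_neq0 // !qpoch_neq0.
Qed.

Lemma qHahn_kernel_degree_preserving m (p : {poly R}) : (size p <= m)%N ->
  exists2 p' : {poly R}, (size p' <= m)%N & forall x, (x <= N)%N ->
  \sum_(y < N.+1) K y x * p.[q ^- y] = p'.[q ^- x].
Proof.
move: p; apply: (@poly_span_ind _ _ (fun k => 'X^k)).
- exists 0 => [|x xN]; rewrite ?size_poly0 // horner0 big1 // => y _.
  by rewrite horner0 mulr0.
- move=> c p r [p' sp Hp] [r' sr Hr]; exists (c *: p' + r') => [|x xN].
    rewrite (leq_trans (size_polyD _ _)) // geq_max sr andbT.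
    exact: leq_trans (size_scale_leq _ _) sp.
  rewrite hornerD hornerZ -Hp // -Hr // mulr_sumr -big_split /=.
  by apply: eq_bigr => y _; rewrite hornerD hornerZ; ring.
- by move=> k; rewrite size_polyXn.
move=> i im.
have sX k : (size ('X^k : {poly R}) <= k.+1)%N by rewrite size_polyXn.
have [p sp Hp] := qHahn_degree_preserving hq b1a2 (sX i).
have /fin_all_exists2[Q sQ HQ] : forall l : 'I_i.+1, exists2 Q : {poly R},
    (size Q <= i.+1)%N & forall x, (x <= N)%N ->
    (\sum_(z < x.+1) qHahn_measure q z x a1 b1 * (q ^- z) ^+ (i - l)) *
    ((q ^- x) ^+ l *
     \sum_(u < (N - x).+1) qHahn_measure q u (N - x) a2 b2 * (q ^- u) ^+ l) =
    Q.[q ^- x].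
  (* Degree count: the mean over [z] has degree at most [i - l] in $q^{-x}$; the mean over [u] has
     degree at most [l] in $q^{-(N-x)}$, and $(q^{-x})^l$ turns it into degree at most [l] in
     $q^{-x}$. *)
  case=> l /= li.
  have [A sA HA] := qHahn_degree_preserving hq a1b1 (sX (i - l)%N).
  have [D sD HD] := qHahn_degree_preserving hq a2b2 (sX l).
  have [D' sD' HD'] := horner_reverse (q ^- N) sD.
  exists (A * D') => [|x xN].
    rewrite (leq_trans (size_polyMleq _ _)) // -subn1 leq_subLR add1n.
    by rewrite (leq_trans (leq_add sA sD')) // addSn addnS subnK.
  rewrite hornerM -HA -HD' ?invr_eq0 ?qX_neq0 //.
  have -> : q ^- N / q ^- x = q ^- (N - x).
    rewrite invrK -[in LHS](subnK xN) exprD; field.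
    by rewrite !qX_neq0.
  rewrite -HD; congr (_ * (_ * _)); apply: eq_bigr => z _; by rewrite hornerXn.
exists (\sum_(l < i.+1) p`_l *: Q l).
  rewrite (leq_trans (size_sum _ _ _)) //; apply/bigmax_leqP => l _.
  by rewrite (leq_trans (size_scale_leq _ _)) // (leq_trans (sQ l)).
move=> x xN; rewrite (qHahn_kernel_sum (fun y => ('X^i).[q ^- y])) // horner_sum.
transitivity (\sum_(z < x.+1) \sum_(u < (N - x).+1) \sum_(l < i.+1) p`_l *
  (qHahn_measure q z x a1 b1 * (q ^- z) ^+ (i - l) *
  ((q ^- x) ^+ l * (qHahn_measure q u (N - x) a2 b2 * (q ^- u) ^+ l)))).
  apply: eq_bigr => -[z /= zx] _; rewrite mulr_sumr; apply: eq_bigr => -[u /= uNx] _.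
  under eq_bigr => v _ do
    rewrite hornerXn exprD invfM exprMn mulrCA -[(q ^- v) ^+ i]hornerXn.
  rewrite -mulr_sumr Hp (horner_coef_wide _ sp) !mulr_sumr.
  apply: eq_bigr => -[l /= li] _.
  have -> : q ^- (x + u - z) = q ^- x * q ^- u / q ^- z.
    have {2}-> : x = (x - z + z)%N by rewrite subnK.
    rewrite -addnBAC //.
    by rewrite !exprD; field; rewrite !qX_neq0.
  (* The factor $(q^{-z})^i$ clears the negative powers of $q^{-z}$ coming from $q^{-(x+u-z)}$,
     since [l <= i]. *)
  rewrite -[in (q ^- z) ^+ i](subnK (_ : (l <= i)%N)) // exprD.
  rewrite expr_div_n exprMn.
  have t0 : (q ^- z) ^+ l != 0 by rewrite expf_neq0 // invr_eq0 qX_neq0.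
  move: (q ^- z) (q ^- x) (q ^- u) t0 => tz tx tu t0; by field.
under eq_bigr => z _ do rewrite exchange_big /=.
rewrite exchange_big /=; apply: eq_bigr => l _.
rewrite hornerZ -HQ // mulr_suml mulr_sumr; apply: eq_bigr => z _.
by rewrite !mulr_sumr.
Qed.

(** From state 0 the first draw is forced to be 0. The other two each contribute one factorial
    moment, and $(q^{-N};q)_k$ cancels against the coefficient of P_n. *)
Lemma qHahn_kernel_poly_at0 n : (n <= N)%N ->
  \sum_(y < N.+1) K y 0 * qHahn_poly q N n y (a1 * b1) (a2 * b2) =
  qHahn_kappa q a1 b1 a2 b2 n.
Proof.
move=> nN; rewrite (qHahn_kernel_sum (fun y => qHahn_poly q N n y _ _)) //.
rewrite big_ord1 /= subn0 qHahn_measureE //= subn0 !qpoch0 expr0 !mulr1 divr1 mul1r.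
set c := qHahn_coef q N n (a1 * b1) (a2 * b2).
transitivity (\sum_(k < n.+1) c k * (qpoch q b1 k / qpoch q (b1 * a2) k *
  (qpoch q a2 k * qpoch q (q ^- N) k / qpoch q (a2 * b2) k))).
  under eq_bigr => u _.
    rewrite add0n subn0.
    under eq_bigr => v _ do rewrite qHahn_polyE mulr_sumr.
    rewrite exchange_big /=.
    under eq_bigr => k _.
      under eq_bigr => v _ do rewrite mulrCA.
      rewrite -mulr_sumr qHahn_factorial_moment //; over.
    rewrite mulr_sumr; over.
  rewrite exchange_big /=; apply: eq_bigr => k _.
  rewrite -qHahn_factorial_moment // !mulr_sumr; apply: eq_bigr => u _.
  by rewrite /c; ring.
rewrite /qHahn_kappa big_mkord; apply: eq_bigr => k _;
rewrite /c /qHahn_coef [a1 * b1 * (_ * _)]mulrA.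
have kN : (k <= N)%N by rewrite (leq_trans _ nN) // -ltnS.
field.
by rewrite qfact_neq0 // qpochV_neq0 // !qpoch_neq0.
Qed.

Lemma qHahn_kernel_eigen n x : (n <= N)%N -> (x <= N)%N ->
  \sum_(y < N.+1) K y x * qHahn_poly q N n y (a1 * b1) (a2 * b2) =
  qHahn_kappa q a1 b1 a2 b2 n * qHahn_poly q N n x (a1 * b1) (a2 * b2).
Proof.
move=> nN xN.
pose w y := qHahn_measure q y N (a1 * b1) (a2 * b2).
have w0 y : 0 < w y by apply: qHahn_measure_gt0.
have [P sP HP] := qHahn_poly_horner hq nN a1b1 a1b1a2b2.
have [G sG HG] : exists2 G : {poly R}, (size G <= n.+1)%N & forall x, (x <= N)%N ->
    \sum_(y < N.+1) K y x * P.[q ^- y] = G.[q ^- x].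
  by apply: qHahn_kernel_degree_preserving; rewrite sP.
have Pn0 : P`_n != 0.
  by have := lead_coef_eq0 P; rewrite lead_coefE sP -size_poly_eq0 sP => ->.
(* [c] cancels the coefficient of ['X^n], so [h] has degree below [n]. *)
pose c := G`_n / P`_n; pose h := G - c *: P.
have sh : (size h <= n)%N.
  apply/leq_sizeP => j; rewrite leq_eqVlt => /orP[/eqP <-|nj].
    by rewrite coefB coefZ divfK // subrr.
  rewrite coefB coefZ [G`_j]nth_default ?(leq_trans sG) //.
  by rewrite nth_default ?sP // mulr0 subrr.
have [H sH HH] := qHahn_kernel_degree_preserving sh.
have orth (r : {poly R}) : (size r <= n)%N ->
    \sum_(y < N.+1) w y * (P.[q ^- y] * r.[q ^- y]) = 0.
  move=> sr; rewrite -[RHS](qHahn_poly_orthogonal hq nN a1b1 a1b1a2b2 sr).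
  by apply: eq_bigr => y _; rewrite HP.
(* With T the operator of [K], G = TP on the state space and T is self-adjoint, so the pairing of G
   with h equals that of P with H = Th, which has degree below [n]. *)
have orthG : \sum_(y < N.+1) w y * (G.[q ^- y] * h.[q ^- y]) = 0.
  rewrite -[RHS](orth H sH).
  under eq_bigr => y _ do rewrite -HG ?leq_ord // mulr_suml mulr_sumr.
  rewrite exchange_big /=; apply: eq_bigr => z _.
  rewrite -HH ?leq_ord // !mulr_sumr; apply: eq_bigr => y _.
  rewrite mulrCA; have rev := qHahn_kernel_reversible (leq_ord z) (leq_ord y).
  transitivity (K z y * w y * (P.[q ^- z] * h.[q ^- y])); first by ring.
  by rewrite /w rev; ring.
have hE y : h.[q ^- y] = G.[q ^- y] - c * P.[q ^- y].
  by rewrite /h hornerD hornerN hornerZ.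
(* [h] is orthogonal to [G] and to [P], hence to itself; positivity of [w] makes it vanish at every
   state. *)
have /psumr_eq0P h0 : \sum_(y < N.+1) w y * h.[q ^- y] ^+ 2 = 0.
  transitivity (\sum_(y < N.+1) w y * (G.[q ^- y] * h.[q ^- y]) -
    c * \sum_(y < N.+1) w y * (P.[q ^- y] * h.[q ^- y])).
    rewrite mulr_sumr -sumrB; apply: eq_bigr => y _.
    by rewrite expr2 {1}hE; ring.
  by rewrite orthG orth // mulr0 subr0.
have Gc y : (y <= N)%N -> G.[q ^- y] = c * P.[q ^- y].
  rewrite -ltnS => yN; have := h0 _ (Ordinal yN) isT => /= h0y.
  have /eqP : w y * h.[q ^- y] ^+ 2 = 0.
    by apply: h0y => z _; rewrite mulr_ge0 ?sqr_ge0 // ltW.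
  rewrite mulf_eq0 gt_eqF //= sqrf_eq0 hE subr_eq0.
  by move/eqP.
have sumG y : (y <= N)%N ->
  \sum_(z < N.+1) K z y * qHahn_poly q N n z (a1 * b1) (a2 * b2) = G.[q ^- y].
  by move=> yN; rewrite -HG //; apply: eq_bigr => z _; rewrite HP.
suff <- : c = qHahn_kappa q a1 b1 a2 b2 n by rewrite sumG // Gc // HP.
by rewrite -qHahn_kernel_poly_at0 // sumG // Gc // -HP (qHahn_poly0 hq) mulr1.
Qed.

End QHahnKernel.

Theorem mainTheorem10 (R : realFieldType) (q : R) (N : nat) (a1 b1 a2 b2 : R)
    (hq : 0 < q < 1) (hN : (1 <= N)%N)
    (ha1 : 0 < a1 < 1) (hb1 : 0 < b1 < 1) (ha2 : 0 < a2 < 1) (hb2 : b2 < 1) :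
  let K (x y : 'I_N.+1) := qHahn_kernel q N a1 b1 a2 b2 x y in
  let w (x : 'I_N.+1) := qHahn_measure q x N (a1 * b1) (a2 * b2) in
  let P (n x : 'I_N.+1) := qHahn_poly q N n x (a1 * b1) (a2 * b2) in
  [/\ forall x y : 'I_N.+1, 0 <= K x y,
      forall y : 'I_N.+1, \sum_(x < N.+1) K x y = 1,
      forall x y : 'I_N.+1, K x y * w y = K y x * w x
    & forall n x : 'I_N.+1,
        \sum_(y < N.+1) K x y * w y * P n y
          = qHahn_kappa q a1 b1 a2 b2 n * w x * P n x].
Proof.
move=> K w P.
have rev (x y : 'I_N.+1) : K x y * w y = K y x * w x.
  by apply: qHahn_kernel_reversible; rewrite // leq_ord.
split=> // [x y|y|n x].
- exact: qHahn_kernel_ge0.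
- by apply: qHahn_kernel_total; rewrite // leq_ord.
(* Detailed balance replaces [w y] by [w x], which leaves the sum; what remains is the eigenvalue
   equation for the transposed kernel. *)
under eq_bigr => y _ do rewrite rev mulrAC.
rewrite -mulr_suml mulrAC; congr (_ * _).
by apply: qHahn_kernel_eigen; rewrite // leq_ord.
Qed.
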